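(* Consider the smart-meter system with infinite battery capacity, $B_{\max}=\infty$, and with peak power constraint $\hat P$ on the amount of energy taken from the battery. Then the minimum information leakage rate $\mathcal{I}^i(\infty,\hat P)=\inf_{f\in\mathcal F}\lim_{n\to\infty}\frac1n I(X^n;Y^n)$, for an i.i.d. input load $X$ and a renewable energy generation process with average power $\bar P_E$, is $$\mathcal{I}^i(\infty,\hat P)=\mathcal{I}(\bar P_E,\hat P),$$ where $\mathcal{I}(\bar P,\hat P)=\inf_{p_{Y|X}\in\mathcal P(\bar P,\hat P)} I(X;Y)$ is the privacy-power function.
   Context: Time is discrete. The input load (user demand) $X_t$ takes values in an alphabet $\mathcal X=[0,\dots,X_{\max}]$, and $(X_t)_{t\ge1}$ is i.i.d. with distribution $p_X$. The renewable energy $E_t$ generated in slot $t$, available at the beginning of that slot, takes values in $\mathcal E=[0,\dots,E_{\max}]$, and $(E_t)_{t\ge1}$ is i.i.d. with distribution $p_E$ and mean $\bar P_E=\mathbb{E}[E]$. The two sequences are independent, and $\bar P_E\le\hat P$. The output load $Y_t$ (energy drawn from the grid, which is what the meter reports) takes values in $\mathcal Y=[0,\dots,Y_{\max}]$, with $Y_{\max}\le X_{\max}$. The realization of the renewable energy is known only to the consumer, causally. $X^n=(X_1,\dots,X_n)$, and similarly for other sequences; $I(\cdot\,;\cdot)$ is mutual information, with logarithms in base 2. Battery: the state of charge is $B_t\in\mathcal B$ and, since the capacity is infinite, $B_{t+1}=B_t+E_t-(X_t-Y_t)$. The battery stores only renewable energy, so the energy available in it is the total renewable energy generated minus the total energy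 taken from the battery so far. An energy management policy is a sequence $f=(f_1,f_2,\dots)$ of maps $f_t:\mathcal X^t\times\mathcal E^t\times\mathcal B^t\times\mathcal Y^{t-1}\to\mathcal Y$ determining $Y_t$ from $(X^t,E^t,B^t,Y^{t-1})$. It is feasible ($f\in\mathcal F$) if, for all $t$, $[X_t-\min\{B_t+E_t,\hat P\}]^+\le Y_t\le X_t$, where $[a]^+=\max\{a,0\}$, and the battery update equation holds; that is, $0\le X_t-Y_t\le\hat P$ for all $t$, and $\sum_{t=1}^m (X_t-Y_t)\le\sum_{t=1}^m E_t$ for all $m$. For the privacy-power function, $X\sim p_X$ and $\mathcal P(\bar P,\hat P)$ is the set of conditional distributions $p_{Y|X}$ with $Y\in\mathcal Y$, $\mathbb{E}[X-Y]\le\bar P$ and $0\le X-Y\le\hat P$.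
   Formalization: Policies may be randomized (f_t gives a distribution from which Y_t is drawn), since with deterministic maps the identity can fail; the set F of feasible policies is assumed nonempty, since it can be empty when Y_max < X_max; the limit is read as a limit superior. *)

(* Defs.v *)
From HB Require Import structures.
From mathcomp Require Import all_boot all_order all_algebra.
From mathcomp Require Import all_classical all_reals all_analysis.

Set Implicit Arguments.
Unset Strict Implicit.
Unset Printing Implicit Defensive.

Import Order.TTheory GRing.Theory Num.Theory.

Local Open Scope classical_set_scope.
Local Open Scope ring_scope.

Record fdist (R : realType) (T : finType) := FDist {
  fdist_fun :> T -> R;
  fdist_ge0 : forall x, 0 <= fdist_fun x;
  fdist_sum1 : \sum_x fdist_fun x = 1 }.

(* The alphabets are [{0, ..., N}], encoded as ['I_N.+1]. *)
Definition mean (R : realType) (N : nat) (p : fdist R 'I_N.+1) : R :=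
  \sum_(i < N.+1) (i : nat)%:R * p i.

Definition log2 (R : realType) (x : R) : R := ln x / ln 2.

(* [p] is the joint mass function of the pair (first, second); terms with
   [p (a, b) = 0] vanish, which is the convention 0 log 0 = 0. *)
Definition mutual_info (R : realType) (S T : finType) (p : S * T -> R) : R :=
  \sum_a \sum_b p (a, b) *
    log2 (p (a, b) / ((\sum_b' p (a, b')) * (\sum_a' p (a', b)))).

Definition prefix_tuple (T : Type) (n k : nat) (le_kn : (k <= n)%N)
    (x : n.-tuple T) : k.-tuple T :=
  [tuple tnth x (widen_ord le_kn i) | i < k].

Section SmartMeter.
Variables (R : realType) (Xmax Emax Ymax : nat).

Local Notation X := ('I_Xmax.+1).
Local Notation E := ('I_Emax.+1).
Local Notation Y := ('I_Ymax.+1).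

(* Slots are numbered from 0, so slot [t] sees [t.+1] loads, energies and
   battery states and [t] past outputs.  The output is drawn from the returned
   distribution, with fresh randomness in each slot; a deterministic map to [Y]
   is the special case of point masses. *)
Definition policy := forall t : nat,
  t.+1.-tuple X -> t.+1.-tuple E -> t.+1.-tuple int -> t.-tuple Y -> fdist R Y.

(* State of charge at the beginning of slot [t], before the energy of that slot
   arrives: the solution of B_{t+1} = B_t + E_t - (X_t - Y_t) starting from the
   empty battery.  It is an integer because the update does not clip, neither at
   a capacity nor at 0; feasible policies keep it nonnegative. *)
Definition soc (n : nat) (x : n.-tuple X) (e : n.-tuple E) (y : n.-tuple Y)
    (t : nat) : int :=
  \sum_(s < n | (s < t)%N)
    ((tnth e s : nat)%:Z - ((tnth x s : nat)%:Z - (tnth y s : nat)%:Z)).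

(* Conditional law of Y_t at the history of slot [t] along the path (x, e, y). *)
Definition policy_at (f : policy) (n : nat) (x : n.-tuple X) (e : n.-tuple E)
    (y : n.-tuple Y) (t : 'I_n) : fdist R Y :=
  f t (prefix_tuple (ltn_ord t) x) (prefix_tuple (ltn_ord t) e)
      [tuple soc x e y s | s < t.+1]
      (prefix_tuple (ltnW (ltn_ord t)) y).

(* Joint law of (X^n, E^n, Y^n): the loads are i.i.d. [pX], the energies are
   i.i.d. [pE] and independent of the loads, the outputs follow [f]. *)
Definition path_law (pX : fdist R X) (pE : fdist R E) (f : policy) (n : nat)
    (x : n.-tuple X) (e : n.-tuple E) (y : n.-tuple Y) : R :=
  \prod_(t < n) (pX (tnth x t) * pE (tnth e t) * policy_at f x e y t (tnth y t)).

Definition law_XY (pX : fdist R X) (pE : fdist R E) (f : policy) (n : nat)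
    (xy : n.-tuple X * n.-tuple Y) : R :=
  \sum_(e : n.-tuple E) path_law pX pE f xy.1 e xy.2.

(* The constraints on the random variables hold almost surely, that is, along
   every path of positive probability. *)
Definition feasible (pX : fdist R X) (pE : fdist R E) (Phat : R) (f : policy) :
    Prop :=
  forall (n : nat) (x : n.-tuple X) (e : n.-tuple E) (y : n.-tuple Y),
    0 < path_law pX pE f x e y ->
    forall t : 'I_n,
      let xt := (tnth x t : nat)%:R : R in
      let et := (tnth e t : nat)%:R : R in
      let yt := (tnth y t : nat)%:R : R in
      let bt := (soc x e y t)%:~R : R in
      Num.max (xt - Num.min (bt + et) Phat) 0 <= yt /\ yt <= xt.

(* The limit of I(X^n; Y^n) / n, taken as a limit superior so that the rate of
   every policy is defined; it is the limit whenever the limit exists. *)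
Definition leakage_rate (pX : fdist R X) (pE : fdist R E) (f : policy) : \bar R :=
  limn_esup (fun n => (mutual_info (law_XY pX pE f (n := n)) / n%:R)%:E).

Definition min_leakage_rate (pX : fdist R X) (pE : fdist R E) (Phat : R) :
    \bar R :=
  ereal_inf [set leakage_rate pX pE f | f in [set f | feasible pX pE Phat f]].

Definition channel_joint (pX : fdist R X) (W : X -> fdist R Y) (xy : X * Y) : R :=
  pX xy.1 * W xy.1 xy.2.

Definition admissible (pX : fdist R X) (Pbar Phat : R) (W : X -> fdist R Y) :
    Prop :=
  \sum_x \sum_y channel_joint pX W (x, y) * ((x : nat)%:R - (y : nat)%:R) <= Pbar
  /\ forall (x : X) (y : Y), 0 < channel_joint pX W (x, y) ->
       0 <= (x : nat)%:R - (y : nat)%:R :> R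
       /\ (x : nat)%:R - (y : nat)%:R <= Phat.

End SmartMeter.

Definition privacy_power (R : realType) (Xmax Ymax : nat)
    (pX : fdist R 'I_Xmax.+1) (Pbar Phat : R) : \bar R :=
  ereal_inf [set (mutual_info (channel_joint pX W))%:E | W in
    [set W : 'I_Xmax.+1 -> fdist R 'I_Ymax.+1 | admissible pX Pbar Phat W]].

(* Main.v *)
Require Import Defs.
From HB Require Import structures.
From mathcomp Require Import all_boot all_order all_algebra.
From mathcomp Require Import all_classical all_reals all_analysis.
From mathcomp Require Import zify lra ring.

Import Order.TTheory GRing.Theory Num.Theory.
Local Open Scope ring_scope.

Set Implicit Arguments.
Unset Strict Implicit.
Unset Printing Implicit Defensive.

(* Both inequalities reduce to Gibbs' inequality [sum P log (P / Q) >= 0].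

   Converse: let [Wbar] be the average over [t < n] of the channels from [X_t] to
   [Y_t].  It is admissible because the energy drawn never exceeds the energy
   harvested.  Since the loads are i.i.d., Gibbs' inequality with
   [Q (x, y) = P (y) prod_t Vbar (x_t | y_t)], where [Vbar] is the reverse channel
   of [Wbar], gives [I (X^n; Y^n) >= n I (X; Wbar)] in one step.

   Achievability: let [M] be the channel that draws as little as possible from the
   battery, [y = min (x, Ymax)].  Feasibility of any policy in the first slot shows
   that the energy of a single slot always pays for [M].  For an admissible [W],
   mix in a little of [M] so that the mean demand drops strictly below the mean
   energy; use the mixture when the charge is at least [Xmax] and [M] otherwise.
   The charge then has positive drift in both regimes, so its negative
   exponential moment decays geometrically and the expected number of
   low-charge slots is bounded.  Comparing [Y^n] with the product of the output laws
   of the mixture, and conditioning on [E^n], the leakage exceeds [n I] by at most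
   a constant.  If no strict slack can be created then [W = M]. *)

(** * Gibbs' inequality and bounds on mutual information *)

Section Information.
Variable R : realType.

Lemma ln2_gt0 : 0 < ln 2 :> R.
Proof. by rewrite ln_gt0// ltr1n. Qed.

Lemma log2M (a b : R) : 0 < a -> 0 < b -> log2 (a * b) = log2 a + log2 b.
Proof. by move=> a0 b0; rewrite /log2 lnM ?posrE// mulrDl. Qed.

Lemma log2V (a : R) : 0 < a -> log2 a^-1 = - log2 a.
Proof. by move=> a0; rewrite /log2 lnV ?posrE// mulNr. Qed.

Lemma log2_div (a b : R) : 0 < a -> 0 < b -> log2 (a / b) = log2 a - log2 b.
Proof. by move=> a0 b0; rewrite log2M ?invr_gt0// log2V. Qed.

Lemma log2_1 : log2 1 = 0 :> R.
Proof. by rewrite /log2 ln1 mul0r. Qed.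

Lemma log2_prod (I : finType) (F : I -> R) :
  (forall i, 0 < F i) -> log2 (\prod_i F i) = \sum_i log2 (F i).
Proof.
move=> F0; suff [_ ->] : 0 < \prod_i F i /\ log2 (\prod_i F i) = \sum_i log2 (F i) by [].
elim/big_rec2: _ => [|i y1 y2 _ [y0 <-]]; first by rewrite log2_1 ltr01.
by rewrite log2M// mulr_gt0.
Qed.

Lemma prodr_gt0P (I : finType) (F : I -> R) :
  (forall i, 0 <= F i) -> 0 < \prod_i F i -> forall i, 0 < F i.
Proof.
move=> F0 P0 i; rewrite lt0r F0 andbT; apply: contraTneq P0 => Fi0.
by rewrite (bigD1 i)//= Fi0 mul0r ltxx.
Qed.

Lemma mulr_gt0P (a b : R) : 0 <= a -> 0 <= b -> 0 < a * b -> 0 < a /\ 0 < b.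
Proof.
rewrite !le0r => /orP[/eqP->|a0]; first by rewrite mul0r ltxx.
by move=> /orP[/eqP->|b0]; first by rewrite mulr0 ltxx.
Qed.

Lemma gt0_or_eq0 (a : R) : 0 <= a -> 0 < a \/ a = 0.
Proof. by rewrite le0r => /orP[/eqP|]; [right|left]. Qed.

Lemma sumr_gt0_term (I : finType) (F : I -> R) i :
  (forall i, 0 <= F i) -> 0 < F i -> 0 < \sum_i F i.
Proof.
move=> F0 Fi; rewrite (bigD1 i)//= ltr_pwDl// sumr_ge0// => j _; exact: F0.
Qed.

(** Termwise, [ln z <= z - 1] at [z = Q x / P x] bounds [P x * ln (P x / Q x)] below by [P x - Q x],
    and these differences have a nonnegative sum. *)
Lemma gibbs (T : finType) (P Q : T -> R) :
  (forall x, 0 <= P x) -> (forall x, 0 <= Q x) ->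
  (forall x, 0 < P x -> 0 < Q x) -> \sum_x Q x <= \sum_x P x ->
  0 <= \sum_x P x * log2 (P x / Q x).
Proof.
move=> P0 Q0 PQ sQP.
suff H x : P x - Q x <= P x * log2 (P x / Q x) * ln 2.
  rewrite -(pmulr_lge0 _ ln2_gt0) mulr_suml; apply: le_trans (ler_sum _ (fun x _ => H x)).
  by rewrite sumrB subr_ge0.
case: (gt0_or_eq0 (P0 x)) => [Px|->]; last by rewrite !mul0r sub0r oppr_le0.
have Qx := PQ _ Px.
rewrite /log2 -mulrA divfK ?gt_eqF ?ln2_gt0//.
have -> : P x / Q x = (Q x / P x)^-1 by rewrite invf_div.
rewrite lnV ?posrE ?divr_gt0//.
have := @ln_sublinear _ (Q x / P x); rewrite divr_gt0// => /(_ isT).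
have := @le_ln1Dx _ (Q x / P x - 1).
have -> : 1 + (Q x / P x - 1) = Q x / P x by ring.
rewrite ltrBrDr addNr divr_gt0// => /(_ isT) h _.
rewrite mulrN -mulNr; apply: le_trans (_ : - P x * (Q x / P x - 1) <= _); last first.
  by rewrite ler_wnM2l// oppr_le0.
suff -> : - P x * (Q x / P x - 1) = P x - Q x by [].
by field; rewrite gt_eqF.
Qed.

Lemma mutual_infoE (S T : finType) (p : S * T -> R) :
  mutual_info p = \sum_st p st *
    log2 (p st / ((\sum_b p (st.1, b)) * (\sum_a p (a, st.2)))).
Proof. by rewrite /mutual_info pair_bigA/=; apply: eq_bigr => -[]. Qed.

(* For [U] independent of [S] this is [I(S;T) <= I(S;T|U)], with the conditional
   law of [T] given [U] replaced by an arbitrary [q]. *)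
Lemma mutual_info_le_cond (S U T : finType) (P : S -> U -> T -> R)
    (pS : S -> R) (pU : U -> R) (q : U -> T -> R) :
  (forall s u t, 0 <= P s u t) ->
  (forall s u, \sum_t P s u t = pS s * pU u) ->
  \sum_s pS s = 1 -> \sum_u pU u = 1 ->
  (forall s, 0 <= pS s) -> (forall u, 0 <= pU u) ->
  (forall u t, 0 <= q u t) -> (forall u, \sum_t q u t <= 1) ->
  (forall s u t, 0 < P s u t -> 0 < q u t) ->
  mutual_info (fun st => \sum_u P st.1 u st.2) <=
  \sum_s \sum_u \sum_t P s u t * log2 (P s u t / (pS s * pU u * q u t)).
Proof.
move=> P0 PSU pS1 pU1 pS0 pU0 q0 q1 Pq.
pose PST s t := \sum_u P s u t.
pose PT t := \sum_s PST s t.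
have PST0 s t : 0 <= PST s t by rewrite sumr_ge0.
have PT0 t : 0 <= PT t by rewrite sumr_ge0.
have PS s : \sum_t PST s t = pS s.
  by rewrite exchange_big/=; under eq_bigr do rewrite PSU; rewrite -mulr_sumr pU1 mulr1.
have pos s u t : 0 < P s u t -> [/\ 0 < PST s t, 0 < PT t, 0 < pS s & 0 < pU u].
  move=> p.
  have a : 0 < PST s t by apply: (sumr_gt0_term (i := u)).
  have b : 0 < PT t by apply: (sumr_gt0_term (i := s)).
  have /mulr_gt0P[]// : 0 < pS s * pU u.
  by rewrite -PSU; apply: (sumr_gt0_term (i := t)).
(* The reference mass [pS * pU * q] is reweighted by the likelihood ratio of the pair (s, t), so
   that [log2 (P' / Q)] is exactly the difference of the two logarithms being compared. *)
pose Q (x : S * U * T) := pS x.1.1 * pU x.1.2 * q x.1.2 x.2 *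
  (PST x.1.1 x.2 / (pS x.1.1 * PT x.2)).
pose P' (x : S * U * T) := P x.1.1 x.1.2 x.2.
have := @gibbs _ P' Q.
have P'1 : \sum_x P' x = 1.
  rewrite -(pair_bigA _ (fun x t => P x.1 x.2 t)) -(pair_bigA _ (fun s u => \sum_t P s u t))/=.
  under eq_bigr do under eq_bigr do rewrite PSU.
  by under eq_bigr do rewrite -mulr_sumr pU1 mulr1.
have Q0 x : 0 <= Q x by rewrite /Q !mulr_ge0// invr_ge0 mulr_ge0.
have Q1 : \sum_x Q x <= 1.
  rewrite -(pair_bigA _ (fun x t => Q (x, t))) exchange_big/=.
  apply: le_trans (_ : \sum_t \sum_u pU u * q u t <= 1); last first.
    rewrite exchange_big/= -pU1; apply: ler_sum => u _.
    by rewrite -mulr_sumr ler_piMr.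
  apply: ler_sum => t _; rewrite -(pair_bigA _ (fun s u => Q (s, u, t))) exchange_big/=.
  apply: ler_sum => u _; rewrite /Q/=.
  (* The factor [pS s] cancels, and what remains is the reverse conditional law of s given t, of
     mass 1, or 0 when [PT t = 0]. *)
  apply: le_trans (_ : \sum_s pU u * q u t * (PST s t / PT t) <= _).
    apply: ler_sum => s _; case: (gt0_or_eq0 (pS0 s)) => [ps|->]; last first.
      by rewrite !mul0r !mulr_ge0// invr_ge0.
    have -> : pU u * q u t * (PST s t / PT t) =
        pS s * pU u * q u t * ((pS s)^-1 * (PST s t / PT t)).
      by move: (PST s t / PT t) => z; field; rewrite gt_eqF.
    by rewrite invfM (mulrCA (pS s)^-1).
  rewrite -mulr_sumr -mulr_suml -/(PT t) ler_piMr ?mulr_ge0//.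
  by have [->|h] := eqVneq (PT t) 0; rewrite ?mul0r// divff.
move=> /(_ (fun x => P0 _ _ _) Q0) /[!P'1] /(_ _ Q1) G.
rewrite -subr_ge0.
rewrite (_ : _ - _ = \sum_x P' x * log2 (P' x / Q x)).
  apply: G => -[[s u] t]; rewrite /P'/Q/= => p.
  have [a b c d] := pos _ _ _ p; have e := Pq _ _ _ p.
  by rewrite !mulr_gt0// invr_gt0 mulr_gt0.
rewrite mutual_infoE/= -(pair_bigA _ (fun s t => (\sum_u P s u t) *
   log2 ((\sum_u P s u t) / ((\sum_b \sum_u P s u b) * (\sum_a \sum_u P a u t)))))/=.
rewrite -(pair_bigA _ (fun x t => P' (x, t) * log2 (P' (x, t) / Q (x, t))))/=.
rewrite -(pair_bigA _ (fun s u => \sum_t P' (s, u, t) * log2 (P' (s, u, t) / Q (s, u, t))))/=.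
rewrite -sumrB; apply: eq_bigr => s _.
under [X in _ - X]eq_bigr do rewrite mulr_suml.
rewrite [X in _ - X]exchange_big -sumrB/=; apply: eq_bigr => u _.
rewrite -sumrB/=; apply: eq_bigr => t _.
rewrite -mulrBr -/(PT t) -/(PST s t) PS /P' /Q/=.
case: (gt0_or_eq0 (P0 s u t)) => [p|->]; last by rewrite !mul0r.
have [a b c d] := pos _ _ _ p; have e := Pq _ _ _ p.
congr (_ * _).
have j : 0 < (pS s * PT t)^-1 by rewrite invr_gt0 mulr_gt0.
rewrite !log2_div ?mulr_gt0// !log2M ?mulr_gt0// log2V ?mulr_gt0// log2M//.
by rewrite opprD opprB; ring.
Qed.

Lemma point_mass_sum1 (T : finType) (t : T) : \sum_x (x == t)%:R = 1 :> R.
Proof. by rewrite (bigD1 t)//= eqxx big1 ?addr0// => x /negPf->. Qed.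

Definition point_mass (T : finType) (t : T) : fdist R T :=
  FDist (fun x => ler0n R (x == t)) (point_mass_sum1 t).

End Information.

(** * Tuples extended by a last entry, and sums over tuples *)

Section Tuples.
Variables (T : finType) (n : nat).
Implicit Types (x : n.-tuple T) (a : T).

Lemma tnth_rcons_widen x a (i : 'I_n) :
  tnth (rcons_tuple x a) (widen_ord (leqnSn n) i) = tnth x i.
Proof. by rewrite !(tnth_nth a)/= nth_rcons size_tuple ltn_ord. Qed.

Lemma tnth_rcons_max x a : tnth (rcons_tuple x a) ord_max = a.
Proof. by rewrite (tnth_nth a)/= nth_rcons size_tuple ltnn eqxx. Qed.

Lemma prefix_tuple_rcons k (le_kn : (k <= n)%N) (le_kSn : (k <= n.+1)%N) x a :
  prefix_tuple le_kSn (rcons_tuple x a) = prefix_tuple le_kn x.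
Proof.
apply: eq_from_tnth => i; rewrite !tnth_mktuple -(tnth_rcons_widen x a).
by congr tnth; exact: val_inj.
Qed.

Lemma prefix_tuple_id (le_nn : (n <= n)%N) x : prefix_tuple le_nn x = x.
Proof.
by apply: eq_from_tnth => i; rewrite tnth_mktuple; congr tnth; exact: val_inj.
Qed.

Lemma tuple_rconsE (z : n.+1.-tuple T) :
  z = rcons_tuple (prefix_tuple (leqnSn n) z) (tnth z ord_max).
Proof.
apply: eq_from_tnth => i; case: (unliftP ord_max i) => [j|] ->.
  rewrite (_ : lift ord_max j = widen_ord (leqnSn n) j); last first.
    by apply: val_inj; rewrite /= /bump leqNgt ltn_ord.
  by rewrite tnth_rcons_widen tnth_mktuple.
by rewrite tnth_rcons_max.
Qed.

Lemma sum_tuple_rcons (V : nmodType) (F : n.+1.-tuple T -> V) :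
  \sum_z F z = \sum_x \sum_a F (rcons_tuple x a).
Proof.
rewrite pair_bigA/= (reindex (fun xa : n.-tuple T * T => rcons_tuple xa.1 xa.2))//.
exists (fun z => (prefix_tuple (leqnSn n) z, tnth z ord_max)) => [[x a] _|z _] /=.
  by rewrite tnth_rcons_max (prefix_tuple_rcons (leqnn n)) prefix_tuple_id.
by rewrite -tuple_rconsE.
Qed.

Lemma sum_tuple_prod (R : comNzRingType) (F : 'I_n -> T -> R) :
  \sum_x \prod_i F i (tnth x i) = \prod_i \sum_a F i a.
Proof.
rewrite bigA_distr_bigA/= (reindex (fun x => [ffun i => tnth x i]))/=; last first.
  exists (fun f : {ffun 'I_n -> T} => [tuple f i | i < n]) => [x _|f _].
    by apply: eq_from_tnth => i; rewrite tnth_mktuple ffunE.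
  by apply/ffunP => i; rewrite ffunE tnth_mktuple.
by apply: eq_bigr => x _; apply: eq_bigr => i _; rewrite ffunE.
Qed.

End Tuples.

(** * Paths and their law *)

Section PathLaw.
Variables (R : realType) (Xmax Emax Ymax : nat).
Local Notation X := ('I_Xmax.+1).
Local Notation E := ('I_Emax.+1).
Local Notation Y := ('I_Ymax.+1).
Variables (pX : fdist R X) (pE : fdist R E).
Implicit Type f : policy R Xmax Emax Ymax.

Lemma soc_rcons n (x : n.-tuple X) (e : n.-tuple E) (y : n.-tuple Y) a b c s :
  (s <= n)%N ->
  soc (rcons_tuple x a) (rcons_tuple e b) (rcons_tuple y c) s = soc x e y s.
Proof.
move=> sn; rewrite /soc big_mkcond big_ord_recr/= ltnNge sn/= addr0 [RHS]big_mkcond.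
by apply: eq_bigr => i _; rewrite !tnth_rcons_widen.
Qed.

Lemma soc_rcons_last n (x : n.-tuple X) (e : n.-tuple E) (y : n.-tuple Y) a b c :
  soc (rcons_tuple x a) (rcons_tuple e b) (rcons_tuple y c) n.+1 =
  soc x e y n + ((b : nat)%:Z - ((a : nat)%:Z - (c : nat)%:Z)).
Proof.
rewrite /soc big_mkcond big_ord_recr/= ltnSn !tnth_rcons_max [in RHS]big_mkcond; congr (_ + _).
by apply: eq_bigr => i _; rewrite !tnth_rcons_widen/= ltn_ord ltnS ltnW.
Qed.

Lemma soc0 n (x : n.-tuple X) (e : n.-tuple E) (y : n.-tuple Y) : soc x e y 0 = 0.
Proof. by rewrite /soc big_pred0. Qed.

Lemma socS n (x : n.-tuple X) (e : n.-tuple E) (y : n.-tuple Y) (t : 'I_n) :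
  soc x e y t.+1 = soc x e y t +
    ((tnth e t : nat)%:Z - ((tnth x t : nat)%:Z - (tnth y t : nat)%:Z)).
Proof.
rewrite /soc (bigD1 t)/= ?ltnSn// addrC; congr (_ + _).
by apply: eq_bigl => i; rewrite ltnS andbC [RHS]ltn_neqAle.
Qed.

(** The output law of slot [n] after a past path and a fresh load and energy. The charges are read
    off the past path alone, since the charge at the beginning of slot [n] is already settled by
    it. *)
Definition next_kernel f n (x : n.-tuple X) (e : n.-tuple E) (y : n.-tuple Y)
    (a : X) (b : E) : fdist R Y :=
  f n (rcons_tuple x a) (rcons_tuple e b) [tuple soc x e y s | s < n.+1] y.

Lemma policy_at_rcons_widen f n (x : n.-tuple X) (e : n.-tuple E)
    (y : n.-tuple Y) a b c (t : 'I_n) :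
  policy_at f (rcons_tuple x a) (rcons_tuple e b) (rcons_tuple y c)
    (widen_ord (leqnSn n) t) = policy_at f x e y t.
Proof.
rewrite /policy_at /= !(prefix_tuple_rcons (ltn_ord t)).
rewrite (prefix_tuple_rcons (ltnW (ltn_ord t))); congr (f _ _ _ _ _).
apply: eq_from_tnth => s; rewrite !tnth_mktuple soc_rcons//.
exact: ltnW (leq_trans (ltn_ord s) (ltn_ord t)).
Qed.

Lemma policy_at_rcons_max f n (x : n.-tuple X) (e : n.-tuple E)
    (y : n.-tuple Y) a b c :
  policy_at f (rcons_tuple x a) (rcons_tuple e b) (rcons_tuple y c) ord_max
  = next_kernel f x e y a b.
Proof.
rewrite /policy_at /next_kernel /= !prefix_tuple_id.
rewrite (prefix_tuple_rcons (leqnn n)) prefix_tuple_id; congr (f _ _ _ _ _).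
by apply: eq_from_tnth => s; rewrite !tnth_mktuple soc_rcons// -ltnS.
Qed.

(** Causality: the factors of the first [n] slots do not see the appended letters. Every induction
    on the horizon rests on this. *)
Lemma path_law_rcons f n (x : n.-tuple X) (e : n.-tuple E) (y : n.-tuple Y) a b c :
  path_law pX pE f (rcons_tuple x a) (rcons_tuple e b) (rcons_tuple y c) =
  path_law pX pE f x e y * (pX a * pE b * next_kernel f x e y a b c).
Proof.
rewrite /path_law big_ord_recr/= !tnth_rcons_max policy_at_rcons_max; congr (_ * _).
by apply: eq_bigr => i _; rewrite !tnth_rcons_widen policy_at_rcons_widen.
Qed.

Lemma path_law_ge0 f n (x : n.-tuple X) (e : n.-tuple E) (y : n.-tuple Y) :
  0 <= path_law pX pE f x e y.
Proof. by apply: prodr_ge0 => t _; rewrite !mulr_ge0 ?fdist_ge0. Qed.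

Lemma path_law_gt0P f n (x : n.-tuple X) (e : n.-tuple E) (y : n.-tuple Y) :
  0 < path_law pX pE f x e y ->
  forall t, [/\ 0 < pX (tnth x t), 0 < pE (tnth e t)
             & 0 < policy_at f x e y t (tnth y t)].
Proof.
move=> /prodr_gt0P h t.
have /mulr_gt0P : 0 < pX (tnth x t) * pE (tnth e t) * policy_at f x e y t (tnth y t).
  by apply: h => i; rewrite !mulr_ge0 ?fdist_ge0.
rewrite mulr_ge0 ?fdist_ge0// => /(_ isT isT)[/mulr_gt0P].
by rewrite !fdist_ge0 => /(_ isT isT)[].
Qed.

Definition iid (T : finType) (p : fdist R T) n (x : n.-tuple T) : R :=
  \prod_t p (tnth x t).

Lemma iid_ge0 (T : finType) (p : fdist R T) n (x : n.-tuple T) : 0 <= iid p x.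
Proof. by apply: prodr_ge0 => t _; exact: fdist_ge0. Qed.

Lemma iid_sum1 (T : finType) (p : fdist R T) n : \sum_(x : n.-tuple T) iid p x = 1.
Proof.
rewrite [LHS](sum_tuple_prod (fun _ a => p a)) big1// => i _; exact: fdist_sum1.
Qed.

Lemma iid_rcons (T : finType) (p : fdist R T) n (x : n.-tuple T) a :
  iid p (rcons_tuple x a) = iid p x * p a.
Proof.
rewrite /iid big_ord_recr/= tnth_rcons_max; congr (_ * _).
by apply: eq_bigr => i _; rewrite tnth_rcons_widen.
Qed.

(** Summing out the outputs from the last slot backwards removes one kernel at a time, so no policy
    can disturb the joint law of loads and energies. *)
Lemma sum_path_law_y f n (x : n.-tuple X) (e : n.-tuple E) :
  \sum_y path_law pX pE f x e y = iid pX x * iid pE e.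
Proof.
elim: n x e => [|n IH] x e.
  rewrite (eq_bigr (fun _ => 1)); last by move=> i _; rewrite /path_law big_ord0.
  by rewrite sumr_const card_tuple expn0 /iid !big_ord0 mulr1.
rewrite (tuple_rconsE x) (tuple_rconsE e); move: (prefix_tuple _ x) (prefix_tuple _ e).
move: (tnth x _) (tnth e _) => a b {}x {}e; rewrite sum_tuple_rcons.
under eq_bigr do under eq_bigr do rewrite path_law_rcons.
under eq_bigr do rewrite -mulr_sumr -mulr_sumr fdist_sum1 mulr1.
by rewrite -mulr_suml IH !iid_rcons mulrACA.
Qed.

Definition path_exp f n (g : n.-tuple X -> n.-tuple E -> n.-tuple Y -> R) : R :=
  \sum_x \sum_e \sum_y path_law pX pE f x e y * g x e y.

(** Tower property: the inner sums are the conditional expectation given the first [n] slots. *)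
Lemma path_expS f n (g : n.+1.-tuple X -> n.+1.-tuple E -> n.+1.-tuple Y -> R) :
  path_exp f g = path_exp f (fun x e y => \sum_a \sum_b \sum_c
    (pX a * pE b * next_kernel f x e y a b c) *
    g (rcons_tuple x a) (rcons_tuple e b) (rcons_tuple y c)).
Proof.
rewrite /path_exp sum_tuple_rcons; apply: eq_bigr => x _.
under eq_bigr do rewrite sum_tuple_rcons.
rewrite exchange_big/=; apply: eq_bigr => e _.
under eq_bigr do under eq_bigr do rewrite sum_tuple_rcons.
under eq_bigr do rewrite exchange_big/=.
rewrite exchange_big/=; apply: eq_bigr => y _.
rewrite mulr_sumr; apply: eq_bigr => a _.
rewrite mulr_sumr; apply: eq_bigr => b _.
rewrite mulr_sumr; apply: eq_bigr => c _.
by rewrite path_law_rcons [RHS]mulrA.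
Qed.

Lemma path_exp_le f n (g h : n.-tuple X -> n.-tuple E -> n.-tuple Y -> R) :
  (forall x e y, 0 < path_law pX pE f x e y -> g x e y <= h x e y) ->
  path_exp f g <= path_exp f h.
Proof.
move=> gh; apply: ler_sum => x _; apply: ler_sum => e _; apply: ler_sum => y _.
case: (gt0_or_eq0 (path_law_ge0 f x e y)) => [p|->]; last by rewrite !mul0r.
by rewrite ler_pM2l// gh.
Qed.

Lemma path_expD f n (g h : n.-tuple X -> n.-tuple E -> n.-tuple Y -> R) :
  path_exp f (fun x e y => g x e y + h x e y) = path_exp f g + path_exp f h.
Proof.
rewrite /path_exp -big_split; apply: eq_bigr => x _.
rewrite -big_split; apply: eq_bigr => e _.
by rewrite -big_split; apply: eq_bigr => y _; rewrite mulrDr.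
Qed.

Lemma path_expZ f n k (g : n.-tuple X -> n.-tuple E -> n.-tuple Y -> R) :
  path_exp f (fun x e y => k * g x e y) = k * path_exp f g.
Proof.
rewrite /path_exp mulr_sumr; apply: eq_bigr => x _.
rewrite mulr_sumr; apply: eq_bigr => e _.
by rewrite mulr_sumr; apply: eq_bigr => y _; rewrite mulrCA.
Qed.

Lemma path_exp_eq f n (g h : n.-tuple X -> n.-tuple E -> n.-tuple Y -> R) :
  (forall x e y, 0 < path_law pX pE f x e y -> g x e y = h x e y) ->
  path_exp f g = path_exp f h.
Proof.
by move=> gh; apply/eqP; rewrite eq_le; apply/andP; split;
  apply: path_exp_le => x e y p; rewrite gh.
Qed.

Lemma path_exp_cst f n k :
  path_exp f (fun (x : n.-tuple X) (e : n.-tuple E) (y : n.-tuple Y) => k) = k.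
Proof.
rewrite /path_exp.
under eq_bigr do under eq_bigr do rewrite -mulr_suml sum_path_law_y.
under eq_bigr do rewrite -mulr_suml -mulr_sumr iid_sum1 mulr1.
by rewrite -mulr_suml iid_sum1 mul1r.
Qed.

Lemma path_exp0 f (g : 0.-tuple X -> 0.-tuple E -> 0.-tuple Y -> R) :
  path_exp f g = g [tuple] [tuple] [tuple].
Proof.
rewrite (path_exp_eq (h := fun _ _ _ => g [tuple] [tuple] [tuple])) ?path_exp_cst//.
by move=> x e y _; rewrite (tuple0 x) (tuple0 e) (tuple0 y).
Qed.

End PathLaw.

(** * Converse *)

Section Converse.
Variables (R : realType) (Xmax Emax Ymax : nat).
Local Notation X := ('I_Xmax.+1).
Local Notation E := ('I_Emax.+1).
Local Notation Y := ('I_Ymax.+1).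
Variables (pX : fdist R X) (pE : fdist R E).
Variable f : policy R Xmax Emax Ymax.

Lemma sum_iid_tnth (T : finType) (p : fdist R T) n (t : 'I_n) (g : T -> R) :
  \sum_(x : n.-tuple T) iid p x * g (tnth x t) = \sum_a p a * g a.
Proof.
(* Placing [g] at index [t] and 1 elsewhere turns the summand into a product over slots. *)
pose F i a := p a * (if i == t then g a else 1).
transitivity (\sum_(x : n.-tuple T) \prod_i F i (tnth x i)).
  apply: eq_bigr => x _; rewrite big_split/= -/(iid p x); congr (_ * _).
  by rewrite (bigD1 t)//= eqxx big1 ?mulr1// => i /negPf->.
rewrite sum_tuple_prod (bigD1 t)//= [X in _ * X]big1 ?mulr1.
  by apply: eq_bigr => a _; rewrite /F eqxx.
move=> i /negPf it; rewrite -(fdist_sum1 p); apply: eq_bigr => a _.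
by rewrite /F it mulr1.
Qed.

Lemma path_exp_load n (t : 'I_n) (g : X -> R) :
  path_exp pX pE f (fun x (e : n.-tuple E) y => g (tnth x t)) = \sum_a pX a * g a.
Proof.
rewrite -(sum_iid_tnth _ t) /path_exp; apply: eq_bigr => x _.
under eq_bigr do rewrite -mulr_suml sum_path_law_y.
by rewrite -mulr_suml -mulr_sumr iid_sum1 mulr1.
Qed.

Lemma path_exp_energy n (t : 'I_n) (g : E -> R) :
  path_exp pX pE f (fun (x : n.-tuple X) e y => g (tnth e t)) = \sum_b pE b * g b.
Proof.
rewrite -(sum_iid_tnth _ t) /path_exp exchange_big; apply: eq_bigr => e _.
under eq_bigr do rewrite -mulr_suml sum_path_law_y.
by rewrite -!mulr_suml iid_sum1 mul1r.
Qed.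

Lemma path_exp_sum n (I : finType)
    (g : I -> n.-tuple X -> n.-tuple E -> n.-tuple Y -> R) :
  path_exp pX pE f (fun x e y => \sum_i g i x e y) = \sum_i path_exp pX pE f (g i).
Proof.
rewrite /path_exp [RHS]exchange_big; apply: eq_bigr => x _.
rewrite [RHS]exchange_big; apply: eq_bigr => e _.
by rewrite [RHS]exchange_big; apply: eq_bigr => y _; rewrite mulr_sumr.
Qed.

Lemma sum_law_XY n (g : n.-tuple X -> n.-tuple Y -> R) :
  \sum_xy law_XY pX pE f xy * g xy.1 xy.2 =
  path_exp pX pE f (fun x (e : n.-tuple E) y => g x y).
Proof.
rewrite -(pair_bigA _ (fun x y => law_XY pX pE f (x, y) * g x y))/=.
apply: eq_bigr => x _; rewrite exchange_big/=; apply: eq_bigr => y _.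
by rewrite /law_XY/= mulr_suml.
Qed.

Lemma law_XY_ge0 n (xy : n.-tuple X * n.-tuple Y) : 0 <= law_XY pX pE f xy.
Proof. by apply: sumr_ge0 => e _; exact: path_law_ge0. Qed.

Lemma sum_law_XY_y n (x : n.-tuple X) : \sum_y law_XY pX pE f (x, y) = iid pX x.
Proof.
rewrite /law_XY/= exchange_big/=.
under eq_bigr do rewrite sum_path_law_y.
by rewrite -mulr_sumr iid_sum1 mulr1.
Qed.

Lemma channel_of_joint (P : X -> Y -> R) :
  (forall a c, 0 <= P a c) -> (forall a, \sum_c P a c = pX a) ->
  exists W : X -> fdist R Y, forall a c, P a c = channel_joint pX W (a, c).
Proof.
move=> P0 PpX.
suff /boolp.choice[W PW] : forall a, exists w : fdist R Y, forall c, P a c = pX a * w c.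
  by exists W.
move=> a.
have [pa|pa] := gt0_or_eq0 (fdist_ge0 pX a).
  have w0 c : 0 <= P a c / pX a by rewrite divr_ge0// ltW.
  have w1 : \sum_c P a c / pX a = 1 by rewrite -mulr_suml PpX divff// gt_eqF.
  by exists (FDist w0 w1) => c /=; rewrite mulrC divfK// gt_eqF.
(* A load of probability zero has no conditional law; any distribution serves, because [P a]
   vanishes. *)
exists (point_mass R ord0) => c; rewrite pa mul0r.
by apply: (psumr_eq0P (P := predT) (F := P a)) => //; rewrite PpX.
Qed.

(** The law of the pair (X_T, Y_T) for a slot T drawn uniformly from the first [n] slots,
    independently of the path. *)
Definition averaged_joint n (a : X) (c : Y) : R :=
  n%:R^-1 * \sum_(t < n) path_exp pX pE f
    (fun x (e : n.-tuple E) y => ((tnth x t == a) && (tnth y t == c))%:R).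

Lemma averaged_joint_ge0 n a c : 0 <= averaged_joint n a c.
Proof.
rewrite mulr_ge0 ?invr_ge0//; apply: sumr_ge0 => t _.
do 3 (apply: sumr_ge0 => ? _); exact: mulr_ge0 (path_law_ge0 _ _ _ _ _ _) _.
Qed.

Lemma sum_averaged_joint n (g : X -> Y -> R) :
  \sum_a \sum_c averaged_joint n a c * g a c =
  n%:R^-1 * path_exp pX pE f (fun x (e : n.-tuple E) y => \sum_t g (tnth x t) (tnth y t)).
Proof.
rewrite path_exp_sum mulr_sumr.
under eq_bigr do under eq_bigr do rewrite /averaged_joint mulr_sumr mulr_suml.
under eq_bigr do rewrite exchange_big/=.
rewrite exchange_big/=; apply: eq_bigr => t _.
transitivity (n%:R^-1 * \sum_a \sum_c path_exp pX pE f
    (fun x (e : n.-tuple E) y => g a c * ((tnth x t == a) && (tnth y t == c))%:R)).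
  rewrite mulr_sumr; apply: eq_bigr => a _; rewrite mulr_sumr; apply: eq_bigr => c _.
  by rewrite path_expZ; ring.
under eq_bigr do rewrite -path_exp_sum.
rewrite -path_exp_sum; congr (_ * _); apply: path_exp_eq => x e y _.
rewrite (bigD1 (tnth x t))//= (bigD1 (tnth y t))//= !eqxx mulr1.
rewrite big1 ?addr0 => [|c /negPf cy]; last by rewrite eq_sym cy mulr0.
rewrite big1 ?addr0// => a /negPf ax; apply: big1 => c _.
by rewrite eq_sym ax mulr0.
Qed.

Lemma averaged_joint_load n a : \sum_c averaged_joint n.+1 a c = pX a.
Proof.
transitivity (n.+1%:R^-1 * path_exp pX pE f
    (fun x (e : n.+1.-tuple E) y => \sum_t (tnth x t == a)%:R)).
  rewrite -(sum_averaged_joint n.+1 (fun a' _ => (a' == a)%:R)).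
  rewrite (bigD1 a)//= [X in _ + X]big1 ?addr0.
    by apply: eq_bigr => c _; rewrite eqxx mulr1.
  by move=> i /negPf ia; apply: big1 => ? _; rewrite ia mulr0.
rewrite path_exp_sum.
under eq_bigr do rewrite (path_exp_load _ (fun a' => (a' == a)%:R)).
rewrite sumr_const card_ord -[X in _ * X]mulr_natl mulKf ?pnatr_eq0//.
rewrite (bigD1 a)//= eqxx mulr1 big1 ?addr0// => i /negPf ia.
by rewrite ia mulr0.
Qed.

Lemma averaged_joint_gt0 n (x : n.-tuple X) (e : n.-tuple E) (y : n.-tuple Y) t :
  0 < path_law pX pE f x e y -> 0 < averaged_joint n (tnth x t) (tnth y t).
Proof.
move=> p; rewrite mulr_gt0//.
  by rewrite invr_gt0 ltr0n (leq_ltn_trans _ (ltn_ord t)).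
have h u (x' : n.-tuple X) (e' : n.-tuple E) (y' : n.-tuple Y) :
  0 <= path_law pX pE f x' e' y' * ((tnth x' u == tnth x t) && (tnth y' u == tnth y t))%:R.
  by rewrite mulr_ge0// path_law_ge0.
apply: (sumr_gt0_term (i := t)) => [u|]; first by do 3 (apply: sumr_ge0 => ? _).
apply: (sumr_gt0_term (i := x)) => [u|]; first by do 2 (apply: sumr_ge0 => ? _).
apply: (sumr_gt0_term (i := e)) => [u|]; first by do 1 (apply: sumr_ge0 => ? _).
by apply: (sumr_gt0_term (i := y)) => [u|]; [exact: h|rewrite !eqxx mulr1].
Qed.

(** Transfers the almost sure constraints from paths to the averaged channel: an average of
    nonnegative terms is positive only if one of them is. *)
Lemma averaged_joint_gt0P n a c : 0 < averaged_joint n a c ->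
  exists (x : n.-tuple X) (e : n.-tuple E) (y : n.-tuple Y) t,
    [/\ 0 < path_law pX pE f x e y, tnth x t = a & tnth y t = c].
Proof.
apply: contraPP => H; apply/negP; rewrite -leNgt.
rewrite mulr_ge0_le0 ?invr_ge0//; apply: sumr_le0 => t _.
apply: sumr_le0 => x _; apply: sumr_le0 => e _; apply: sumr_le0 => y _.
have [p|->] := gt0_or_eq0 (path_law_ge0 pX pE f x e y); last by rewrite mul0r.
rewrite pmulr_rle0//; case: andP => // -[/eqP xa /eqP yc]; case: H.
by exists x, e, y, t.
Qed.

Lemma mutual_info_law_XY_ge n (W : X -> fdist R Y) :
  (forall a c, averaged_joint n.+1 a c = channel_joint pX W (a, c)) ->
  n.+1%:R * mutual_info (channel_joint pX W) <= mutual_info (law_XY pX pE f (n := n.+1)).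
Proof.
move=> PW; pose P := averaged_joint n.+1.
pose PY c := \sum_a P a c.
pose V a c := P a c / PY c.
pose law := law_XY pX pE f (n := n.+1).
pose LY y := \sum_x law (x, y).
have P0 a c : 0 <= P a c by exact: averaged_joint_ge0.
have PY0 c : 0 <= PY c by apply: sumr_ge0.
have V0 a c : 0 <= V a c by rewrite divr_ge0.
(* Division by zero makes [V] vanish at outputs of probability zero, so it may be a subprobability
   there; Gibbs' inequality tolerates this. *)
have V1 c : \sum_a V a c <= 1.
  rewrite -mulr_suml -/(PY c).
  by have [->|h] := eqVneq (PY c) 0; rewrite ?mul0r// divff.
have LY0 y : 0 <= LY y by apply: sumr_ge0 => x _; exact: law_XY_ge0.
have law_gt0 x y : 0 < law (x, y) -> [/\ 0 < LY y, 0 < iid pX x,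
   forall t, 0 < pX (tnth x t), forall t, 0 < P (tnth x t) (tnth y t) &
   forall t, 0 < PY (tnth y t)].
  move=> l.
  have ly : 0 < LY y by apply: (sumr_gt0_term (i := x)) => // z; exact: law_XY_ge0.
  have lx : 0 < iid pX x.
    rewrite -(sum_law_XY_y x).
    by apply: (sumr_gt0_term (i := y)) => // z; exact: law_XY_ge0.
  have [e pe] : exists e, 0 < path_law pX pE f x e y.
    apply: contrapT => H; move: l; rewrite ltNge => /negP; apply.
    apply: sumr_le0 => e _; rewrite leNgt; apply/negP => h; apply: H; by exists e.
  have Pt t : 0 < P (tnth x t) (tnth y t) by exact: averaged_joint_gt0 pe.
  split=> // t; first by have [] := path_law_gt0P pe t.
  exact: (sumr_gt0_term (i := tnth x t)).
pose Q (xy : n.+1.-tuple X * n.+1.-tuple Y) := LY xy.2 * \prod_t V (tnth xy.1 t) (tnth xy.2 t).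
have G : 0 <= \sum_xy law xy * log2 (law xy / Q xy).
  apply: gibbs => [xy|xy|[x y] l|].
  - exact: law_XY_ge0.
  - by rewrite mulr_ge0// prodr_ge0.
  - have [ly lx px Pt PYt] := law_gt0 _ _ l.
    by rewrite mulr_gt0// prodr_gt0// => t _; rewrite divr_gt0.
  rewrite -(pair_bigA _ (fun x y => Q (x, y))) -(pair_bigA _ (fun x y => law (x, y)))/=.
  rewrite exchange_big [leRHS]exchange_big/=; apply: ler_sum => y _; rewrite /Q/=.
  rewrite -mulr_sumr -/(LY y) ler_piMr// (sum_tuple_prod (fun t a => V a (tnth y t))).
  by apply: prodr_ile1 => t _; rewrite V1 sumr_ge0.
(* The information density of the averaged channel. The expectation of its sum over slots is [n.+1]
   times its mean under the averaged law, however dependent the slots are. *)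
pose h a c := log2 (V a c / pX a).
have Eh : n.+1%:R * mutual_info (channel_joint pX W) =
    \sum_xy law xy * \sum_t h (tnth xy.1 t) (tnth xy.2 t).
  rewrite (sum_law_XY (fun x y => \sum_t h (tnth x t) (tnth y t))).
  rewrite -[RHS](mulVKf (_ : n.+1%:R != 0)) ?pnatr_eq0// -sum_averaged_joint; congr (_ * _).
  rewrite /mutual_info; apply: eq_bigr => a _; apply: eq_bigr => c _.
  rewrite -PW; congr (_ * log2 _).
  under eq_bigr do rewrite -PW; under [X in _ / (_ * X)]eq_bigr do rewrite -PW.
  by rewrite averaged_joint_load -/(PY c) /V -/(P a c) invfM mulrA mulrAC.
rewrite Eh -subr_ge0 (_ : _ - _ = \sum_xy law xy * log2 (law xy / Q xy))//.
rewrite mutual_infoE -sumrB; apply: eq_bigr => -[x y] _ /=.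
rewrite -mulrBr -/law.
case: (gt0_or_eq0 (law_XY_ge0 (x, y))) => [l|]; last by rewrite -/law => ->; rewrite !mul0r.
have [ly lx px Pt PYt] := law_gt0 _ _ l.
have Vt t : 0 < V (tnth x t) (tnth y t) by rewrite divr_gt0.
(* The loads are i.i.d., so the logarithm of [iid pX x] splits over slots and cancels against the
   [pX] in the densities [h]. *)
congr (_ * _); rewrite sum_law_XY_y -/(LY y) /Q/=.
have vp : 0 < \prod_t V (tnth x t) (tnth y t) by apply: prodr_gt0.
rewrite !log2_div ?mulr_gt0// !log2M// !log2_prod//.
under eq_bigr do rewrite /h log2_div//.
by rewrite sumrB; ring.
Qed.

(** Unfolds the clipped lower bound on the output into linear constraints; drawing at most charge
    plus fresh energy is the same as leaving a nonnegative charge for the next slot. *)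
Lemma feasible_gt0 Phat n (x : n.-tuple X) (e : n.-tuple E) (y : n.-tuple Y) t :
  feasible pX pE Phat f -> 0 < path_law pX pE f x e y ->
  [/\ 0 <= (tnth x t : nat)%:R - (tnth y t : nat)%:R :> R,
      (tnth x t : nat)%:R - (tnth y t : nat)%:R <= Phat,
      (tnth x t : nat)%:R - (tnth y t : nat)%:R <=
        (soc x e y t)%:~R + (tnth e t : nat)%:R :> R
    & 0 <= (soc x e y t.+1)%:~R :> R ].
Proof.
move=> /(_ n x e y) /[apply] /(_ t)/=.
rewrite ge_max ler0n andbT lerBlDr -lerBlDl le_min => -[/andP[h1 h2] h3].
split=> //; first by rewrite subr_ge0.
rewrite socS !(rmorphD, rmorphB)/=.
by rewrite !pmulrn in h2 *; lra.
Qed.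

Lemma soc_intr n (x : n.-tuple X) (e : n.-tuple E) (y : n.-tuple Y) :
  (soc x e y n)%:~R = \sum_t ((tnth e t : nat)%:R -
    ((tnth x t : nat)%:R - (tnth y t : nat)%:R)) :> R.
Proof.
rewrite /soc rmorph_sum/=; apply: eq_big => [t|t _]; first by rewrite ltn_ord.
by rewrite !rmorphB/= !pmulrn.
Qed.

Lemma averaged_joint_admissible Phat n (W : X -> fdist R Y) :
  feasible pX pE Phat f ->
  (forall a c, averaged_joint n.+1 a c = channel_joint pX W (a, c)) ->
  admissible pX (mean pE) Phat W.
Proof.
move=> F PW; split; last first.
  move=> a c; rewrite -PW => /averaged_joint_gt0P[x [e [y [t [p <- <-]]]]].
  by have [] := feasible_gt0 t F p.
under eq_bigr do under eq_bigr do rewrite -PW.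
rewrite (sum_averaged_joint _ (fun a c => (a : nat)%:R - (c : nat)%:R)).
rewrite ler_pdivrMl ?ltr0n//.
apply: le_trans (_ : path_exp pX pE f (fun (x : n.+1.-tuple X) e y => \sum_t (tnth e t : nat)%:R) <= _).
  apply: path_exp_le => x e y p.
  (* A nonnegative charge after the last slot says that the total energy drawn is at most the total
     harvested. *)
  have [_ _ _] := feasible_gt0 ord_max F p.
  by rewrite soc_intr sumrB subr_ge0.
rewrite path_exp_sum.
under eq_bigr do rewrite (path_exp_energy _ (fun b => (b : nat)%:R)).
rewrite sumr_const card_ord -[leLHS]mulr_natl ler_pM2l ?ltr0n// le_eqVlt; apply/orP; left; apply/eqP.
by apply: eq_bigr => b _; rewrite mulrC.
Qed.

End Converse.

(** * Achievability *)

Section Channels.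
Variables (R : realType) (Xmax Ymax : nat).
Local Notation X := ('I_Xmax.+1).
Local Notation Y := ('I_Ymax.+1).
Variable pX : fdist R X.
Implicit Types W V : X -> fdist R Y.

Definition output_law W (c : Y) : R := \sum_a channel_joint pX W (a, c).

(** Conditional relative entropy of [W] to [q] given the load. The reference [q] is free so that it
    can be the output law of another channel. *)
Definition channel_divergence W (q : Y -> R) : R :=
  \sum_a pX a * \sum_c W a c * log2 (W a c / q c).

Lemma mutual_info_channelE W :
  mutual_info (channel_joint pX W) = channel_divergence W (output_law W).
Proof.
apply: eq_bigr => a _; rewrite mulr_sumr; apply: eq_bigr => c _.
rewrite (_ : \sum_b channel_joint pX W (a, b) = pX a); last first.
  by rewrite /channel_joint/= -mulr_sumr fdist_sum1 mulr1.
rewrite {1 2}/channel_joint/= -mulrA.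
have [pa|->] := gt0_or_eq0 (fdist_ge0 pX a); last by rewrite !mul0r.
by rewrite -mulf_div divff ?mul1r// gt_eqF.
Qed.

Lemma mix_fdist_ge0 (T : finType) (k : R) (p q : fdist R T) :
  0 <= k <= 1 -> forall x, 0 <= (1 - k) * p x + k * q x.
Proof.
by move=> /andP[k0 k1] x; rewrite addr_ge0// mulr_ge0 ?fdist_ge0// subr_ge0.
Qed.

Lemma mix_fdist_sum1 (T : finType) (k : R) (p q : fdist R T) :
  \sum_x ((1 - k) * p x + k * q x) = 1.
Proof. by rewrite big_split/= -!mulr_sumr !fdist_sum1 !mulr1 subrK. Qed.

Definition mix_fdist (T : finType) (k : R) (k01 : 0 <= k <= 1) (p q : fdist R T) :=
  FDist (mix_fdist_ge0 p q k01) (mix_fdist_sum1 k p q).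

(* Conditioning on the independent coin that selects [W] or [V]. *)
Lemma mutual_info_mix k (k01 : 0 <= k <= 1) W V :
  mutual_info (channel_joint pX (fun a => mix_fdist k01 (W a) (V a))) <=
  (1 - k) * mutual_info (channel_joint pX W) + k * mutual_info (channel_joint pX V).
Proof.
have /andP[k0 k1] := k01.
pose pU (u : bool) : R := if u then 1 - k else k.
pose Z (u : bool) := if u then W else V.
(* With the output law of the selected channel as reference, the conditional bound becomes the
   average of the two mutual informations. *)
pose q u := output_law (Z u).
have pU0 u : 0 <= pU u by case: u => //=; rewrite subr_ge0.
have J0 u a c : 0 <= channel_joint pX (Z u) (a, c) by rewrite mulr_ge0 ?fdist_ge0.
have := @mutual_info_le_cond _ _ _ _ (fun a u c => pX a * pU u * Z u a c) pX pU q.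
rewrite (_ : mutual_info _ = mutual_info (channel_joint pX (fun a => mix_fdist k01 (W a) (V a)))); last first.
  congr mutual_info; apply/funext => -[a c]; rewrite big_bool /channel_joint/=.
  by ring.
move=> H; apply: le_trans (H _ _ _ _ _ _ _ _ _) _ => {H}.
- by move=> a u c; rewrite !mulr_ge0 ?fdist_ge0.
- by move=> a u; rewrite -mulr_sumr fdist_sum1 mulr1.
- exact: fdist_sum1.
- by rewrite big_bool/= subrK.
- exact: fdist_ge0.
- exact: pU0.
- by move=> u c; apply: sumr_ge0.
- move=> u; rewrite exchange_big/= /channel_joint/=.
  under eq_bigr do rewrite -mulr_sumr fdist_sum1 mulr1.
  by rewrite fdist_sum1.
- move=> a u c /mulr_gt0P[]; rewrite ?mulr_ge0 ?fdist_ge0//.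
  move=> /mulr_gt0P[]; rewrite ?fdist_ge0// => pa _ z.
  by apply: (sumr_gt0_term (i := a)) => //; rewrite mulr_gt0.
rewrite le_eqVlt; apply/orP; left; apply/eqP.
transitivity (\sum_u pU u * mutual_info (channel_joint pX (Z u))); last by rewrite big_bool.
rewrite exchange_big; apply: eq_bigr => u _.
rewrite mutual_info_channelE /channel_divergence mulr_sumr; apply: eq_bigr => a _.
rewrite mulrA mulr_sumr; apply: eq_bigr => c _.
have [pa|->] := gt0_or_eq0 (fdist_ge0 pX a); last by rewrite !(mul0r, mulr0).
have [pu|->] := gt0_or_eq0 (pU0 u); last by rewrite !(mul0r, mulr0).
by rewrite -mulf_div divff ?gt_eqF ?mulr_gt0// mul1r mulrA (mulrC (pX a)).
Qed.

End Channels.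

(** * The switching policy: feasibility, leakage, and low-charge slots *)

Section Achievability.
Variables (R : realType) (Xmax Emax Ymax : nat).
Local Notation X := ('I_Xmax.+1).
Local Notation E := ('I_Emax.+1).
Local Notation Y := ('I_Ymax.+1).
Variables (pX : fdist R X) (pE : fdist R E).
Variables (W V : X -> fdist R Y).

(* A charge of [Xmax] covers every possible demand, so the channel [W] can be
   used without regard to the load or the energy of the slot. *)
Definition switching_policy : policy R Xmax Emax Ymax := fun t x e b y =>
  if Xmax%:Z <= tnth b ord_max then W (tnth x ord_max) else V (tnth x ord_max).
Local Notation f := switching_policy.

Lemma switching_policy_at n (x : n.-tuple X) (e : n.-tuple E) (y : n.-tuple Y) t :
  policy_at f x e y t =
  if Xmax%:Z <= soc x e y t then W (tnth x t) else V (tnth x t).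
Proof.
rewrite /policy_at /f !tnth_mktuple/=.
by rewrite (_ : widen_ord _ _ = t)//; exact: val_inj.
Qed.

Lemma switching_next_kernel n (x : n.-tuple X) (e : n.-tuple E) (y : n.-tuple Y) a b :
  next_kernel f x e y a b = if Xmax%:Z <= soc x e y n then W a else V a.
Proof. by rewrite /next_kernel /f !tnth_mktuple/= tnth_rcons_max. Qed.

(** By induction the charge stays nonnegative: a charge of at least [Xmax] covers any demand, and
    below that level [V] draws no more than the energy of the current slot. *)
Lemma switching_feasible Phat :
  (forall a c, 0 < pX a -> 0 < W a c -> (c <= a)%N /\ (a : nat)%:R - (c : nat)%:R <= Phat) ->
  (forall a b c, 0 < pX a -> 0 < pE b -> 0 < V a c ->
     [/\ (c <= a)%N, (a : nat)%:R - (c : nat)%:R <= Phat & (a <= c + b)%N]) ->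
  feasible pX pE Phat f.
Proof.
move=> hW hV n x e y p.
have H (t : 'I_n) : 0 <= soc x e y t -> [/\ (tnth y t <= tnth x t)%N,
    (tnth x t : nat)%:R - (tnth y t : nat)%:R <= Phat &
    (tnth x t : nat)%:Z <= soc x e y t + (tnth e t : nat)%:Z + (tnth y t : nat)%:Z].
  move=> s0; have [px pe] := path_law_gt0P p t; rewrite switching_policy_at.
  case: ifP => [s1 w|_ v].
    have [-> ->] := hW _ _ px w; split => //.
    have : (tnth x t <= Xmax)%N by rewrite -ltnS.
    by move: s1; lia.
  by have [-> -> h] := hV _ _ _ px pe v; split=> //; move: s0; lia.
have S k : (k <= n)%N -> 0 <= soc x e y k.
  elim: k => [|k IH] kn; first by rewrite soc0.
  have := H (Ordinal kn) (IH (ltnW kn)); rewrite (socS _ _ _ (Ordinal kn))/= => -[_ _].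
  by lia.
move=> t /=; have [h1 h2 h3] := H t (S t (ltnW (ltn_ord t))).
rewrite ge_max ler0n andbT lerBlDr -lerBlDl le_min h2 andbT; split; last by rewrite ler_nat.
move: h3; rewrite -(ler_int R) !rmorphD/= -!pmulrn => h3.
by lra.
Qed.

Local Notation q := (output_law pX W).
Local Notation J := (channel_divergence pX V q).

(** Absolute continuity: the outputs of the fallback channel [V] stay in the support of [q], which
    keeps every log ratio against [q] finite. *)
Hypothesis VW : forall a c, 0 < pX a -> 0 < V a c -> 0 < W a c.

(** Indicator that the policy falls back on [V] in slot [n], the slot following the path. *)
Definition low_charge n (x : n.-tuple X) (e : n.-tuple E) (y : n.-tuple Y) : R :=
  (soc x e y n < Xmax%:Z)%R%:R.

Let q_ge0 c : 0 <= q c.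
Proof. by apply: sumr_ge0 => a _; rewrite mulr_ge0 ?fdist_ge0. Qed.

Let q_gt0 a c : 0 < pX a -> 0 < W a c -> 0 < q c.
Proof.
move=> pa w; apply: (sumr_gt0_term (i := a)); last by rewrite mulr_gt0.
by move=> i; rewrite mulr_ge0 ?fdist_ge0.
Qed.

Let q_sum1 : \sum_c q c = 1.
Proof.
rewrite exchange_big/= /channel_joint/=.
under eq_bigr do rewrite -mulr_sumr fdist_sum1 mulr1.
by rewrite fdist_sum1.
Qed.

(** Log-likelihood ratio of the path law against the law whose outputs are i.i.d. [q] and
    independent of loads and energies. *)
Let llr n (x : n.-tuple X) (e : n.-tuple E) (y : n.-tuple Y) : R :=
  log2 (path_law pX pE f x e y / (iid pX x * iid pE e * \prod_t q (tnth y t))).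

Let prod_q_gt0 n (x : n.-tuple X) (e : n.-tuple E) (y : n.-tuple Y) :
  0 < path_law pX pE f x e y -> 0 < \prod_t q (tnth y t).
Proof.
move=> p; apply: prodr_gt0 => t _.
have [px _] := path_law_gt0P p t; rewrite switching_policy_at.
by case: ifP => _ h; apply: (q_gt0 px) => //; exact: VW.
Qed.

(** Conditioning on the independent energies can only increase the information, and the reference
    output law may ignore them. *)
Lemma mutual_info_le_llr n :
  mutual_info (law_XY pX pE f (n := n)) <= path_exp pX pE f (@llr n).
Proof.
apply: (mutual_info_le_cond (P := fun x e y => path_law pX pE f x e y)
   (q := fun _ y => \prod_t q (tnth y t))).
- exact: path_law_ge0.
- exact: sum_path_law_y.
- exact: iid_sum1.
- exact: iid_sum1.
- exact: iid_ge0.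
- exact: iid_ge0.
- by move=> _ y; apply: prodr_ge0.
- by move=> _; rewrite (sum_tuple_prod (fun _ c => q c)) big1.
- exact: prod_q_gt0.
Qed.

(** Chain rule: given the past, the new slot contributes the divergence from [q] of the channel in
    use. This is the mutual information of [W] at high charge and [J] at low charge. *)
Lemma llrS n : path_exp pX pE f (@llr n.+1) <= path_exp pX pE f (@llr n) +
  (mutual_info (channel_joint pX W) +
   `|J - mutual_info (channel_joint pX W)| * path_exp pX pE f (@low_charge n)).
Proof.
set I := mutual_info _.
rewrite -path_expZ; set k := `|_|.
rewrite -[I](path_exp_cst pX pE f n) -!path_expD path_expS {}/k.
apply: path_exp_le => x e y p.
pose D K := channel_divergence pX K q.
set K := fun a => if Xmax%:Z <= soc x e y n then W a else V a.
(* The past fixes the channel [K] in use; the new factors [pX a] and [pE b] cancel in the ratio,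
   leaving [K a c / q c]. *)
rewrite [leLHS](_ : _ = llr x e y + D K); last first.
  transitivity (\sum_a \sum_b \sum_c pX a * pE b * K a c * (llr x e y + log2 (K a c / q c))).
    apply: eq_bigr => a _; apply: eq_bigr => b _; apply: eq_bigr => c _.
    rewrite switching_next_kernel -/(K a).
    have [pa|->] := gt0_or_eq0 (fdist_ge0 pX a); last by rewrite !mul0r.
    have [pb|->] := gt0_or_eq0 (fdist_ge0 pE b); last by rewrite mulr0 !mul0r.
    have [k|->] := gt0_or_eq0 (fdist_ge0 (K a) c); last by rewrite mulr0 !mul0r.
    have qc : 0 < q c.
      by move: k; rewrite /K; case: ifP => _ h; apply: (q_gt0 pa) => //; exact: VW.
    have ix : 0 < iid pX x by apply: prodr_gt0 => t _; have [] := path_law_gt0P p t.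
    have ie : 0 < iid pE e by apply: prodr_gt0 => t _; have [] := path_law_gt0P p t.
    have iq := prod_q_gt0 p.
    congr (_ * _); rewrite /llr -log2M ?divr_gt0 ?mulr_gt0//; congr log2.
    rewrite path_law_rcons !iid_rcons switching_next_kernel -/(K a) big_ord_recr/= tnth_rcons_max.
    under eq_bigr do rewrite tnth_rcons_widen.
    by field; rewrite !gt_eqF.
  transitivity (\sum_a pX a * \sum_c (K a c * llr x e y + K a c * log2 (K a c / q c))).
    apply: eq_bigr => a _; rewrite exchange_big mulr_sumr; apply: eq_bigr => c _/=.
    rewrite -mulr_suml -mulr_suml -mulr_sumr fdist_sum1 mulr1 -mulrA mulrDr; congr (_ * _).
  under eq_bigr do rewrite big_split/= -mulr_suml fdist_sum1 mul1r mulrDr.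
  by rewrite big_split/= -mulr_suml fdist_sum1 mul1r.
rewrite lerD2l.
have DW : D W = I by rewrite /I mutual_info_channelE.
rewrite /low_charge /K ltNge; case: (Xmax%:Z <= _)=> /=.
  by rewrite mulr0 addr0 -DW.
rewrite mulr1 (_ : D _ = J)//.
by rewrite -lerBlDl ler_norm.
Qed.

Lemma mutual_info_switching_le n : mutual_info (law_XY pX pE f (n := n)) <=
  n%:R * mutual_info (channel_joint pX W) +
  `|J - mutual_info (channel_joint pX W)| *
    \sum_(t < n) path_exp pX pE f (@low_charge t).
Proof.
apply: le_trans (mutual_info_le_llr n) _.
elim: n => [|n IH].
  rewrite big_ord0 mulr0 mul0r addr0 path_exp0 /llr /path_law /iid !big_ord0.
  by rewrite !mulr1 divr1 log2_1.
apply: le_trans (llrS n) _.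
by rewrite big_ord_recr/= -natr1 mulrDl mul1r mulrDr; lra.
Qed.

(** Moment generating function, at [- l], of the change of charge in one slot governed by [K]. *)
Definition charge_mgf (K : X -> fdist R Y) (l : R) : R := \sum_a \sum_b \sum_c
  pX a * pE b * K a c * expR (- (l * ((b : nat)%:R - ((a : nat)%:R - (c : nat)%:R)))).

(** Given the past, one more slot multiplies the exponential moment by that of [W] or of [V], hence
    by at most [r]. *)
Lemma exp_charge_le (l r : R) n : 0 <= r -> charge_mgf W l <= r -> charge_mgf V l <= r ->
  path_exp pX pE f (fun (x : n.-tuple X) e y => expR (- (l * (soc x e y n)%:~R))) <= r ^+ n.
Proof.
move=> r0 hW hV; elim: n => [|n IH].
  by rewrite path_exp0 soc0 mulr0 oppr0 expR0 expr0.
rewrite path_expS exprS; apply: le_trans (ler_wpM2l r0 IH).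
rewrite -path_expZ; apply: path_exp_le => x e y _.
pose K := fun a => if Xmax%:Z <= soc x e y n then W a else V a.
rewrite [leLHS](_ : _ = charge_mgf K l * expR (- (l * (soc x e y n)%:~R))).
  by rewrite ler_wpM2r ?expR_ge0// /K; case: (Xmax%:Z <= _).
rewrite mulr_suml; apply: eq_bigr => a _; rewrite mulr_suml; apply: eq_bigr => b _.
rewrite mulr_suml; apply: eq_bigr => c _.
rewrite switching_next_kernel soc_rcons_last -[RHS]mulrA -expRD; congr (_ * expR _).
by rewrite rmorphD !rmorphB/= -!pmulrn; ring.
Qed.

(** Chernoff bound: the indicator of a charge below [Xmax] is at most [expR (l * (Xmax - charge))].
    The resulting geometric series is bounded uniformly in [n]. *)
Lemma sum_low_charge_le (l r : R) n : 0 < l -> 0 <= r < 1 -> charge_mgf W l <= r -> charge_mgf V l <= r ->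
  \sum_(t < n) path_exp pX pE f (@low_charge t) <= expR (l * Xmax%:R) / (1 - r).
Proof.
move=> l0 /andP[r0 r1] hW hV.
apply: le_trans (_ : \sum_(t < n) expR (l * Xmax%:R) * r ^+ t <= _).
  apply: ler_sum => t _; apply: le_trans (ler_wpM2l (expR_ge0 _) (exp_charge_le t r0 hW hV)).
  rewrite -path_expZ; apply: path_exp_le => x e y _.
  rewrite -expRD /low_charge; case: ltP => h; last exact: expR_ge0.
  rewrite -[leLHS]expR0 ler_expR -mulrBr pmulr_rge0// subr_ge0.
  by rewrite pmulrn ler_int ltW.
rewrite -mulr_sumr ler_wpM2l ?expR_ge0// -[leRHS]div1r ler_pdivlMr ?subr_gt0//.
have := subrX1 r n; have := exprn_ge0 n r0; lra.
Qed.

End Achievability.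

(** * Bounds on upper limits *)

Section LimSup.
Variables (R : realType).
Local Open Scope classical_set_scope.

(** The shift to [n.+1] leaves out the horizon 0, where the leakage rate is a quotient by zero; an
    upper limit ignores that term. *)
Lemma limn_esup_ge (u : nat -> \bar R) (l : \bar R) :
  (forall n, (l <= u n.+1)%E) -> (l <= limn_esup u)%E.
Proof.
move=> lu; rewrite /limn_esup limf_esupE; apply: le_ereal_inf_tmp => _ [V [N _ NV] <-].
apply: le_ereal_sup_tmp; exists (u N.+1) => //; exists N.+1 => //.
by apply: NV => /=.
Qed.

Lemma limn_esup_div_le (u : nat -> R) (l C : R) :
  (forall n, u n <= n%:R * l + C) -> (limn_esup (fun n => (u n / n%:R)%:E) <= l%:E)%E.
Proof.
move=> ul; apply/lee_addgt0Pr => d d0.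
rewrite /limn_esup limf_esupE; apply: ge_ereal_inf.
(* From [k] on, [C / n] is at most [d]; the added 1 keeps [k] positive. *)
pose k := `|C| / d + 1.
have k0 : 0 < k by rewrite ltr_wpDl// divr_ge0// ltW.
exists (ereal_sup ((fun n => (u n / n%:R)%:E) @` [set n | k <= n%:R])).
  by exists [set n | k <= n%:R] => //; exact: nbhs_infty_ger.
apply: ge_ereal_sup => _ [n /= kn <-]; rewrite lee_fin.
have n0 : 0 < n%:R :> R by exact: lt_le_trans kn.
rewrite ler_pdivrMr//; apply: le_trans (ul n) _.
rewrite mulrDl mulrC lerD2l.
apply: le_trans (ler_norm C) _; rewrite mulrC -ler_pdivrMr//.
by apply: le_trans kn; rewrite lerDl.
Qed.

End LimSup.

(** * Exponential moments of variables with positive mean *)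

Section Drift.
Variable R : realType.

(** From [expR u >= 1 + u], since [(1 + u) * (1 - u + 2 * u ^+ 2) = 1 + u ^+ 2 * (1 + 2 * u)] is at
    least 1 in this range. *)
Lemma expRN_le (u : R) : `|u| <= 2^-1 -> expR (- u) <= 1 - u + 2 * u ^+ 2.
Proof.
rewrite ler_norml => /andP[u1 u2].
have p : 0 < 1 + u by lra.
rewrite expRN; apply: le_trans (_ : (1 + u)^-1 <= _).
  by rewrite lef_pV2 ?posrE ?expR_gt0// expR_ge1Dx.
rewrite -[leLHS]div1r ler_pdivrMr//.
have : 0 <= u ^+ 2 * (1 + 2 * u) by rewrite mulr_ge0 ?sqr_ge0//; lra.
by lra.
Qed.

(** To second order the moment is at most [1 - l * mu + 2 * (l * K) ^+ 2], and the linear term wins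
    for small [l]. A whole interval of [l] lets two channels share one exponent. *)
Lemma mgf_lt1 (T : finType) (w Z : T -> R) :
  (forall x, 0 <= w x) -> \sum_x w x = 1 -> 0 < \sum_x w x * Z x ->
  exists2 l0 : R, 0 < l0 &
    forall l, 0 < l <= l0 -> \sum_x w x * expR (- (l * Z x)) < 1.
Proof.
move=> w0 w1; set mu := \sum_x _ => mu0.
pose K := 1 + \sum_x `|Z x|.
have K1 : 1 <= K by rewrite lerDl sumr_ge0.
have ZK x : `|Z x| <= K.
  by rewrite /K (bigD1 x)//= addrCA lerDl addr_ge0// sumr_ge0.
have K0 : 0 < K by exact: lt_le_trans K1.
(* The first bound keeps [l * Z x] within the range of the quadratic estimate; the second makes the
   quadratic term at most half the linear one. *)
exists (Num.min (2 * K)^-1 (mu / (4 * K ^+ 2))).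
  by rewrite lt_min invr_gt0 divr_gt0// ?mulr_gt0// exprn_gt0.
move=> l /andP[l0]; rewrite le_min => /andP[l1 l2].
have lK : l * K <= 2^-1.
  by move: l1; rewrite -[leRHS]div1r ler_pdivlMr ?mulr_gt0//; lra.
have lmu : 2 * (l * K ^+ 2) < mu.
  move: l2; rewrite ler_pdivlMr ?mulr_gt0 ?exprn_gt0//.
  have : 0 < l * K ^+ 2 by rewrite mulr_gt0 ?exprn_gt0.
  lra.
apply: le_lt_trans (_ : \sum_x (w x - l * (w x * Z x) + w x * (2 * (l * K) ^+ 2)) < 1).
  apply: ler_sum => x _; rewrite [leRHS](_ : _ = w x * (1 - l * Z x + 2 * (l * K) ^+ 2)); last by ring.
  have lZ : `|l * Z x| <= l * K by rewrite normrM gtr0_norm// ler_pM2l.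
  rewrite ler_wpM2l//; apply: le_trans (expRN_le (le_trans lZ lK)) _.
  rewrite lerD2l ler_pM2l// -[(l * Z x) ^+ 2]real_normK ?num_real//.
  by rewrite lerXn2r ?nnegrE// mulr_ge0// ltW.
rewrite big_split/= sumrB -mulr_sumr -mulr_suml w1 mul1r -/mu.
have : 0 < l * (mu - 2 * (l * K ^+ 2)) by rewrite mulr_gt0// subr_gt0.
by lra.
Qed.

End Drift.

(** * The upper bound on the minimum leakage rate *)

Section Upper.
Variables (R : realType) (Xmax Emax Ymax : nat).
Local Notation X := ('I_Xmax.+1).
Local Notation E := ('I_Emax.+1).
Local Notation Y := ('I_Ymax.+1).
Variables (pX : fdist R X) (pE : fdist R E).

Definition demand (W : X -> fdist R Y) : R :=
  \sum_a \sum_c channel_joint pX W (a, c) * ((a : nat)%:R - (c : nat)%:R).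

(** The mean change of charge in one slot is [mean pE - demand W], a positive drift. *)
Lemma charge_mgf_lt1 (W : X -> fdist R Y) : demand W < mean pE ->
  exists2 l0 : R, 0 < l0 & forall l, 0 < l <= l0 -> charge_mgf pX pE W l < 1.
Proof.
move=> dW.
pose w (u : X * E * Y) := pX u.1.1 * pE u.1.2 * W u.1.1 u.2.
pose Z (u : X * E * Y) : R := (u.1.2 : nat)%:R - ((u.1.1 : nat)%:R - (u.2 : nat)%:R).
have sumT (g : X -> E -> Y -> R) :
    \sum_u g u.1.1 u.1.2 u.2 = \sum_a \sum_b \sum_c g a b c.
  by rewrite [RHS]pair_bigA [RHS]pair_bigA.
have [] := @mgf_lt1 _ _ w Z.
- by move=> u; rewrite !mulr_ge0 ?fdist_ge0.
- rewrite (sumT (fun a b c => pX a * pE b * W a c)).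
  under eq_bigr do under eq_bigr do rewrite -mulr_sumr fdist_sum1 mulr1.
  under eq_bigr do rewrite -mulr_sumr fdist_sum1 mulr1.
  exact: fdist_sum1.
- rewrite (sumT (fun a b c => pX a * pE b * W a c * ((b : nat)%:R - ((a : nat)%:R - (c : nat)%:R)))).
  rewrite (_ : \sum_a _ = mean pE - demand W) ?subr_gt0//.
  transitivity (\sum_a (pX a * mean pE -
      \sum_c channel_joint pX W (a, c) * ((a : nat)%:R - (c : nat)%:R))).
    apply: eq_bigr => a _.
    transitivity (\sum_(b : E) (pX a * ((b : nat)%:R * pE b) - pE b *
      \sum_c channel_joint pX W (a, c) * ((a : nat)%:R - (c : nat)%:R))).
      apply: eq_bigr => b _.
      transitivity (\sum_(c : Y) (pX a * pE b * (b : nat)%:R * W a c - pE b *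
         (channel_joint pX W (a, c) * ((a : nat)%:R - (c : nat)%:R)))).
        by apply: eq_bigr => c _; rewrite /channel_joint/=; ring.
      by rewrite sumrB -!mulr_sumr fdist_sum1; ring.
    by rewrite sumrB -mulr_sumr -mulr_suml fdist_sum1 mul1r.
  by rewrite sumrB -mulr_suml fdist_sum1 mul1r.
move=> l0 l00 H; exists l0 => // l /H.
by rewrite (sumT (fun a b c => pX a * pE b * W a c * expR (- (l * ((b : nat)%:R - ((a : nat)%:R - (c : nat)%:R)))))).
Qed.

Definition largest_output (a : X) : Y := inord (minn a Ymax).

(** No output bounded by the load draws less energy, so this demand is unavoidable. *)
Definition least_demand (a : X) : fdist R Y := point_mass R (largest_output a).

Lemma largest_outputE a : largest_output a = minn a Ymax :> nat.
Proof. by rewrite inordK// ltnS geq_minr. Qed.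

Lemma least_demand_gt0 a c : 0 < least_demand a c -> c = largest_output a.
Proof. by rewrite /=; case: eqP => //; rewrite ltxx. Qed.

Variable Phat : R.

(** The battery starts empty, so some output of [f] meets load [a] using only energy [b] and
    respecting the peak. The largest output draws no more than that one. *)
Lemma feasible_first_slot (f : policy R Xmax Emax Ymax) (a : X) (b : E) :
  feasible pX pE Phat f -> 0 < pX a -> 0 < pE b ->
  [/\ (largest_output a <= a)%N,
     (a : nat)%:R - (largest_output a : nat)%:R <= Phat
   & (a <= largest_output a + b)%N].
Proof.
move=> F pa pb; rewrite largest_outputE geq_minl.
pose x : 1.-tuple X := rcons_tuple [tuple] a.
pose e : 1.-tuple E := rcons_tuple [tuple] b.
have [y py] : exists y, 0 < path_law pX pE f x e y.
  apply: contrapT => H; have : 0 < \sum_y path_law pX pE f x e y.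
    by rewrite sum_path_law_y !iid_rcons /iid !big_ord0 !mul1r mulr_gt0.
  rewrite ltNge => /negP; apply; apply: sumr_le0 => y _.
  by rewrite leNgt; apply/negP => h; apply: H; exists y.
have [] := feasible_gt0 ord_max F py.
rewrite !tnth_rcons_max soc0 add0r; set c := tnth y _.
rewrite subr_ge0 ler_nat => ca h1 + _; rewrite lerBlDr -natrD ler_nat => h2.
have cm : (c <= minn a Ymax)%N by rewrite leq_min ca -ltnS ltn_ord.
split=> //; last by move: cm h2; lia.
by apply: le_trans h1; rewrite lerD2l lerN2 ler_nat.
Qed.

Lemma switching_rate_le (W V : X -> fdist R Y) (C : R) :
  feasible pX pE Phat (switching_policy W V) ->
  (forall n, mutual_info (law_XY pX pE (switching_policy W V) (n := n)) <=
     n%:R * mutual_info (channel_joint pX W) + C) ->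
  (min_leakage_rate Ymax pX pE Phat <= (mutual_info (channel_joint pX W))%:E)%E.
Proof.
move=> F H; apply: ge_ereal_inf.
exists (leakage_rate pX pE (switching_policy W V)).
  by exists (switching_policy W V).
exact: limn_esup_div_le H.
Qed.

Lemma fdist_exists_gt0 (T : finType) (p : fdist R T) : exists t, 0 < p t.
Proof.
apply: contrapT => H; have := ltr01 (R := R); rewrite -(fdist_sum1 p) ltNge => /negP; apply.
by apply: sumr_le0 => t _; rewrite leNgt; apply/negP => h; apply: H; exists t.
Qed.

(** Separates the unavoidable demand from an excess whose terms are nonnegative for admissible [W].
    This yields both the minimality of [least_demand] and its equality case. *)
Lemma demandE W : demand W =
  demand least_demand + \sum_a \sum_c channel_joint pX W (a, c) *
     ((largest_output a : nat)%:R - (c : nat)%:R).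
Proof.
rewrite -big_split/=; apply: eq_bigr => a _.
transitivity (pX a * ((a : nat)%:R - (largest_output a : nat)%:R) +
   \sum_c channel_joint pX W (a, c) * ((largest_output a : nat)%:R - (c : nat)%:R)).
  rewrite -[X in X * _ + _]mulr1 -(fdist_sum1 (W a)) !mulr_sumr mulr_suml -big_split/=.
  by apply: eq_bigr => c _; rewrite /channel_joint/=; ring.
congr (_ + _); rewrite (bigD1 (largest_output a))//= big1 ?addr0.
  by rewrite /channel_joint/= eqxx mulr1.
by move=> c /negPf ca; rewrite /channel_joint/= ca mulr0 mul0r.
Qed.

Lemma min_leakage_rate_le (W : X -> fdist R Y) :
  (exists f : policy R Xmax Emax Ymax, feasible pX pE Phat f) ->
  admissible pX (mean pE) Phat W ->
  (min_leakage_rate Ymax pX pE Phat <= (mutual_info (channel_joint pX W))%:E)%E.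
Proof.
move=> [f F] [dW hW]; rewrite -/(demand W) in dW.
set I := mutual_info _.
pose M := least_demand.
have hM a b c : 0 < pX a -> 0 < pE b -> 0 < M a c ->
   [/\ (c <= a)%N, (a : nat)%:R - (c : nat)%:R <= Phat & (a <= c + b)%N].
  by move=> pa pb /least_demand_gt0 ->; exact: feasible_first_slot F pa pb.
have hW' a c : 0 < pX a -> 0 < W a c ->
   (c <= a)%N /\ (a : nat)%:R - (c : nat)%:R <= Phat.
  move=> pa w; have [|h ->] := hW a c; first by rewrite mulr_gt0.
  by rewrite -(ler_nat R) -subr_ge0.
have [b pb] := fdist_exists_gt0 pE.
have hM' a c : 0 < pX a -> 0 < M a c ->
   (c <= a)%N /\ (a : nat)%:R - (c : nat)%:R <= Phat.
  by move=> pa m; have [] := hM _ _ _ pa pb m.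
have excess_ge0 a c : 0 <= channel_joint pX W (a, c) *
     ((largest_output a : nat)%:R - (c : nat)%:R).
  have [pa|pa] := gt0_or_eq0 (fdist_ge0 pX a); last by rewrite /channel_joint/= pa !mul0r.
  have [w|w] := gt0_or_eq0 (fdist_ge0 (W a) c); last by rewrite /channel_joint/= w mulr0 mul0r.
  rewrite mulr_ge0 ?mulr_ge0 ?fdist_ge0// subr_ge0 ler_nat largest_outputE leq_min.
  by have [-> _] := hW' _ _ pa w; rewrite -ltnS ltn_ord.
have MW : demand M <= demand W.
  by rewrite (demandE W) lerDl; do 2 (apply: sumr_ge0 => ? _).
have [dM|dM] := ltP (demand M) (mean pE); last first.
  (* Here [mean pE <= demand M <= demand W <= mean pE], so every excess term vanishes and, at loads
     of positive probability, [W] is concentrated on the largest output. *)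
  have WM : channel_joint pX W = channel_joint pX M.
    have : \sum_a \sum_c channel_joint pX W (a, c) *
       ((largest_output a : nat)%:R - (c : nat)%:R) = 0.
      by have := demandE W; rewrite -/M; lra.
    move/psumr_eq0P => H; apply/funext => -[a c].
    have /psumr_eq0P H1 := H (fun a _ => sumr_ge0 _ (fun c _ => excess_ge0 a c)) a isT.
    have {}H1 := H1 (fun c _ => excess_ge0 a c).
    have [pa|pa] := gt0_or_eq0 (fdist_ge0 pX a); last by rewrite /channel_joint/= pa !mul0r.
    have W0 d : d != largest_output a -> W a d = 0.
      move=> dl; have /eqP := H1 d isT; rewrite /channel_joint/= !mulf_eq0 (gt_eqF pa)/=.
      rewrite subr_eq0 eqr_nat => /orP[/eqP//|/eqP /val_inj ld].
      by rewrite ld eqxx in dl.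
    rewrite /channel_joint/=; congr (_ * _).
    have [->|cl] := eqVneq c (largest_output a); last by rewrite W0.
    by rewrite -(fdist_sum1 (W a)) (bigD1 (largest_output a))//= big1 ?addr0.
  (* Both regimes use [M], so the low-charge penalty is zero and no drift is required. *)
  rewrite /I WM; apply: (switching_rate_le (V := M) (C := 0)).
    exact: switching_feasible.
  move=> n; apply: le_trans (mutual_info_switching_le _ _ _) _ => //.
  by rewrite mutual_info_channelE subrr normr0 mul0r.
have mixed k : 0 < k <= 1 -> (min_leakage_rate Ymax pX pE Phat <=
    ((1 - k) * I + k * mutual_info (channel_joint pX M))%:E)%E.
  move=> /andP[k0 k1]; have k01 : 0 <= k <= 1 by rewrite ltW.
  apply: le_trans (_ : (_%:E <= _)%E); last by rewrite lee_fin; exact: (mutual_info_mix _ k01).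
  set Wk := fun a => mix_fdist k01 (W a) (M a).
  have dk : demand Wk < mean pE.
    have -> : demand Wk = (1 - k) * demand W + k * demand M.
      rewrite !mulr_sumr -big_split/=; apply: eq_bigr => a _.
      rewrite !mulr_sumr -big_split/=; apply: eq_bigr => c _.
      by rewrite /channel_joint/=; ring.
    have : (1 - k) * demand W <= (1 - k) * mean pE by rewrite ler_wpM2l// subr_ge0.
    have : k * demand M < k * mean pE by rewrite ltr_pM2l.
    by lra.
  have [l1 l10 H1] := charge_mgf_lt1 dk.
  have [l2 l20 H2] := charge_mgf_lt1 dM.
  (* A common exponent for both regimes; [r] below is then their common contraction ratio. *)
  pose l := Num.min l1 l2.
  have l0 : 0 < l by rewrite lt_min l10.
  pose r := Num.max (charge_mgf pX pE Wk l) (charge_mgf pX pE M l).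
  have r01 : 0 <= r < 1.
    rewrite le_max gt_max H1 ?H2 ?l0 ?ge_min ?lexx ?orbT//= andbT.
    apply/orP; left; do 3 (apply: sumr_ge0 => ? _).
    by rewrite !mulr_ge0 ?fdist_ge0 ?expR_ge0.
  pose C := `|channel_divergence pX M (output_law pX Wk) -
    mutual_info (channel_joint pX Wk)| * (expR (l * Xmax%:R) / (1 - r)).
  apply: (switching_rate_le (V := M) (C := C)).
    apply: switching_feasible hM => a c pa.
    have [w _|w] := gt0_or_eq0 (fdist_ge0 (W a) c); first exact: hW'.
    by rewrite /= w mulr0 add0r pmulr_rgt0//; exact: hM'.
  move=> n; apply: le_trans (mutual_info_switching_le _ _ _) _.
    (* The positive weight [k] makes the mixture charge every output that [M] can produce. *)
    move=> a c _ m; rewrite /= ltr_wpDl ?mulr_gt0//.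
    by rewrite mulr_ge0 ?fdist_ge0// subr_ge0.
  rewrite lerD2l ler_wpM2l//; apply: (sum_low_charge_le _ l0 r01).
    by rewrite le_max lexx.
  by rewrite le_max lexx orbT.
apply/lee_addgt0Pr => d d0.
set J := mutual_info (channel_joint pX M) in mixed.
(* The mixture costs [k * (J - I)] above [I]; this weight keeps that within [d], and the added 1
   avoids a zero denominator. *)
pose k := Num.min 1 (d / (1 + `|J - I|)).
have q0 : 0 < 1 + `|J - I| by rewrite ltr_pwDl.
have k0 : 0 < k <= 1 by rewrite lt_min ltr01 divr_gt0//= ge_min lexx.
apply: le_trans (mixed _ k0) _; rewrite -EFinD lee_fin.
have /andP[k1 _] := k0.
have : k * (J - I) <= k * (1 + `|J - I|).
  by rewrite ler_pM2l//; have := ler_norm (J - I); lra.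
have : k * (1 + `|J - I|) <= d.
  by rewrite -ler_pdivlMr// ge_min lexx orbT.
by lra.
Qed.

End Upper.

Theorem theorem2 (R : realType) (Xmax Emax Ymax : nat)
  (pX : fdist R 'I_Xmax.+1) (pE : fdist R 'I_Emax.+1) (Phat : R)
  (hYX : (Ymax <= Xmax)%N)
  (hPhat : mean pE <= Phat)
  (hF : exists f : policy R Xmax Emax Ymax, feasible pX pE Phat f) :
  min_leakage_rate Ymax pX pE Phat =
  privacy_power Ymax pX (mean pE) Phat.
Proof.
apply/eqP; rewrite eq_le; apply/andP; split.
  by apply: le_ereal_inf_tmp => _ [W hW <-]; exact: min_leakage_rate_le.
(* The averaged channel varies with the horizon, but each one is admissible, so the infimum bounds
   the normalised information at every positive horizon. *)
apply: le_ereal_inf_tmp => _ [f F <-]; apply: limn_esup_ge => n.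
have [W HW] := channel_of_joint (averaged_joint_ge0 pX pE f n.+1) (averaged_joint_load pX pE f n).
apply: ge_ereal_inf; exists (mutual_info (channel_joint pX W))%:E.
  by exists W => //; exact: averaged_joint_admissible F HW.
by rewrite lee_fin ler_pdivlMr ?ltr0n// mulrC; exact: mutual_info_law_XY_ge.
Qed.
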